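(* Let $d\geqslant 2$ be an integer. If $\omega(d)\leqslant\min\{p : p \text{ prime},\ p\mid d\}$, then $L(d)\leqslant 4\,\omega(d)^3$.
   Context: $\omega(d)$ is the number of distinct prime factors of $d$. For a positive integer $Q$, $\mathcal F_Q$ is the set of rational numbers $\frac{a}{q}\in(0,1]$ with $(a,q)=1$ and $1\leqslant q\leqslant Q$ (Farey fractions of order $Q$), where $(m,n)$ denotes the gcd. Write its elements in increasing order as $\gamma_1<\gamma_2<\cdots$, with $\gamma_i=\frac{a_i}{q_i}$ in lowest terms. For a positive integer $d$, $L(d)$ is the smallest nonnegative integer $L$ such that for every $Q$ and every string $\gamma_i<\gamma_{i+1}<\cdots<\gamma_{i+L}$ of $L+1$ consecutive elements of $\mathcal F_Q$, there is $j\in\{0,1,\dots,L\}$ with $(q_{i+j},d)=1$. *)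

(* Defs.v *)
From mathcomp Require Import all_boot all_order all_algebra.

Set Implicit Arguments.
Unset Strict Implicit.
Unset Printing Implicit Defensive.

Import Order.TTheory GRing.Theory Num.Theory.
Local Open Scope ring_scope.

Definition omega (d : nat) : nat := size (primes d).

(* Indices start at 0: gamma_i in the usual numbering is nth 0 (farey Q) i.-1. *)
Definition farey (Q : nat) : seq rat :=
  sort <=%R (undup
    [seq (t.2)%:R / (t.1)%:R
       | t <- [seq (q, a) | q <- iota 1 Q, a <- iota 1 q] & coprime t.2 t.1]).

(* denq is positive, so absz only casts int to nat. *)
Definition farey_den (Q i : nat) : nat := absz (denq (nth 0 (farey Q) i)).

Definition coprime_in_strings (d L : nat) : Prop :=
  forall Q i : nat, (0 < Q)%N -> (i + L < size (farey Q))%N ->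
  exists2 j : nat, (j <= L)%N & coprime (farey_den Q (i + j)) d.

(* The graph of d |-> L(d): asserting [is_L d L] includes the claim that the
   minimum exists. *)
Definition is_L (d L : nat) : Prop :=
  coprime_in_strings d L /\
  forall M : nat, coprime_in_strings d M -> (L <= M)%N.

Lemma mem_farey (Q : nat) (x : rat) :
  reflect (exists a q : nat, [/\ (1 <= q <= Q)%N, coprime a q,
                                 x = a%:R / q%:R & 0 < x <= 1])
          (x \in farey Q).
Proof.
rewrite mem_sort mem_undup; apply: (iffP mapP) => [[[q a]]|].
  rewrite mem_filter /= => /andP[cop /allpairsPdep[q' [a' [hq ha [e1 e2]]]]] ->.
  subst q' a'; move: hq ha; rewrite !mem_iota !add1n !ltnS => hq /andP[a0 aq].
  have q0 : 0 < q%:R :> rat by rewrite ltr0n; case/andP: hq.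
  exists a, q; split=> //.
  apply/andP; split; first by rewrite divr_gt0 // ltr0n.
  by rewrite ler_pdivrMr // mul1r ler_nat.
case=> a [q [hq cop -> /andP[x0 x1]]].
have q0 : 0 < q%:R :> rat by rewrite ltr0n; case/andP: hq.
exists (q, a) => //; rewrite mem_filter cop /=; apply/allpairsPdep.
exists q, a; split=> //; rewrite mem_iota add1n ltnS //.
move: x0 x1; rewrite pmulr_lgt0 ?invr_gt0 // ltr0n => ->.
by rewrite ler_pdivrMr // mul1r ler_nat.
Qed.

Lemma farey_sorted (Q : nat) : sorted <%R (farey Q).
Proof. by rewrite lt_sorted_uniq_le sort_uniq undup_uniq sort_le_sorted. Qed.

Lemma denq_frac (a q : nat) :
  (0 < q)%N -> coprime a q -> `|denq (a%:R / q%:R)|%N = q.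
Proof.
move=> q0 cop; rewrite -[a%:R]/(a%:Z%:~R) -[q%:R]/(q%:Z%:~R).
by rewrite coprimeq_den // eqz_nat; case: eqP q0 => // ->.
Qed.

(* Main.v *)
(* Suppose that no denominator in a string of consecutive elements of F_Q is
   coprime to d, let w = omega d, and let e = a/q be the element of the string with
   the least denominator. As q > 1, e is the mediant of two fractions R, S of
   denominators r + s = q; by minimality these lie outside the string, so that every
   element of the string is x R + y S with x, y >= 1 coprime. As w <= pdiv d, w + 2
   consecutive terms of a progression k r + s with r, s coprime include one coprime
   to d, and w terms suffice when r is not coprime to d. Hence x < (w + 2) y and
   y < (w + 2) x. If (2w - 1) q <= Q, progressions of difference q near e show that
   the string has at most 2w - 1 elements. Otherwise x r + y s <= Q < (2w - 1) (r + s)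
   gives x <= 2w - 2 or y <= 2w - 2, and there are at most
   (w + 1) (2w - 2) (2w - 1) <= 4 w^3 such pairs (x, y). *)
Require Import Defs.
From mathcomp Require Import all_boot all_order all_algebra.
From mathcomp Require Import zify.
From Stdlib Require Import Classical_Prop.

Set Implicit Arguments.
Unset Strict Implicit.
Unset Printing Implicit Defensive.

Import Order.TTheory GRing.Theory Num.Theory.

(** * Primes of [d] in arithmetic progressions *)

Lemma not_coprime_prime (m d : nat) :
  0 < d -> ~~ coprime m d -> exists2 p, p \in primes d & p %| m.
Proof.
move=> d0; case: m => [|m]; last first.
  rewrite coprime_has_primes // negbK => /hasP[p pd pm]; exists p => //.
  by move: pm; rewrite /= mem_primes => /and3P[].
rewrite /coprime gcd0n => d1; exists (pdiv d); last exact: dvdn0.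
by rewrite mem_primes pdiv_prime ?d0 ?pdiv_dvd //; case: d d0 d1 => [|[]].
Qed.

(** Pigeonhole: two of the [n] terms pick the same prime [p], which then divides [(j - i) * r]; were
    [p] to divide [r], it would also divide [s]. *)
Lemma ap_collision (A : seq nat) (n r s : nat) :
  all prime A -> coprime r s -> size A < n ->
  (forall k, k < n -> exists2 p, p \in A & p %| s + k * r) ->
  exists p i j, [/\ p \in A, i < j < n, p %| s + i * r & p %| j - i].
Proof.
move=> /allP prA cop szA hA.
pose f k := find (fun p => p %| s + k * r) A.
have hasA k : k < n -> has (fun p => p %| s + k * r) A.
  by move=> /hA[p pA pk]; apply/hasP; exists p.
have : ~~ uniq (map f (iota 0 n)).
  apply: contraL szA => un; rewrite -leqNgt -(size_iota 0 (size A)).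
  rewrite -{1}(size_iota 0 n) -(size_map f); apply: uniq_leq_size => // t.
  move=> /mapP[k]; rewrite !mem_iota !add0n => /andP[_ kn] ->.
  by rewrite -has_find hasA.
case/(uniqPn 0)=> i [j []]; rewrite size_map size_iota => ij jn.
have iN := ltn_trans ij jn.
rewrite !(nth_map 0) ?size_iota // !nth_iota // !add0n => eqf.
have pi := nth_find 0 (hasA _ iN); have pj := nth_find 0 (hasA _ jn).
move: pj; rewrite -/(f j) -eqf => pj; set p := nth 0 A (f i) in pj.
have pA : p \in A by rewrite mem_nth // -has_find hasA.
exists p, i, j; split=> //; first by rewrite ij.
have pij : p %| (j - i) * r.
  by rewrite mulnBl -(subnDl s) dvdn_sub.
move: pij; rewrite Euclid_dvdM ?prA // => /orP[//|pr].
have ps : p %| s by rewrite -(dvdn_addl s (dvdn_mull i pr)).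
have : p %| gcdn r s by rewrite dvdn_gcd pr.
by rewrite (eqP cop) dvdn1 => /eqP p1; move: (prA _ pA); rewrite p1.
Qed.

Lemma pdiv_min_primes (d p : nat) : p \in primes d -> pdiv d <= p.
Proof.
by rewrite mem_primes => /and3P[pp _ pd]; apply: pdiv_min_dvd => //; exact: prime_gt1.
Qed.

(** A prime dividing both [d] and [q] divides no term, so fewer than [omega d] primes serve
    [omega d] terms. Two terms share one of them, which divides a distance below [omega d] although
    it is at least [pdiv d]. *)
Lemma ap_noncoprime_step (d q s : nat) :
  0 < d -> omega d <= pdiv d -> coprime q s -> ~~ coprime q d ->
  ~ (forall k, k < omega d -> ~~ coprime (s + k * q) d).
Proof.
move=> d0 hd cop /(not_coprime_prime d0)[p0 p0d p0q] nc.
pose A := [seq p <- primes d | ~~ (p %| q)].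
have prA : all prime A.
  apply/allP=> p; rewrite mem_filter mem_primes => /andP[_ /and3P[]//].
have szA : size A < omega d.
  rewrite size_filter /omega -(count_predC (fun p => ~~ (p %| q)) (primes d)).
  rewrite -[X in X < _]addn0 ltn_add2l -has_count.
  by apply/hasP; exists p0; rewrite //= p0q.
case: (ap_collision prA cop szA) => [k kw|p [i [j [pA ij _ pij]]]].
  have [p pd ps] := not_coprime_prime d0 (nc k kw).
  exists p => //; rewrite mem_filter pd andbT; apply/negP => pq.
  have p_s : p %| s by rewrite -(dvdn_addl s (dvdn_mull k pq)).
  have : p %| gcdn q s by rewrite dvdn_gcd pq.
  by rewrite (eqP cop) dvdn1 => /eqP p1; move: pd; rewrite p1 mem_primes.
have pd : p \in primes d by move: pA; rewrite mem_filter => /andP[].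
have := dvdn_leq _ pij; have := pdiv_min_primes pd.
by lia.
Qed.

(* Among omega d + 1 consecutive terms, two share a prime p of d; p divides
   their distance, so p = omega d and the two terms are the extreme ones.
   Applied to the first and to the last omega d + 1 terms, this makes two
   consecutive terms divisible by omega d. *)
Lemma ap_coprime_term (d r s : nat) :
  0 < d -> omega d <= pdiv d -> coprime r s ->
  ~ (forall k, k < (omega d).+2 -> ~~ coprime (s + k * r) d).
Proof.
move=> d0 hd cop nc.
have prd : all prime (primes d).
  by apply/allP=> p; rewrite mem_primes => /and3P[].
have dvd_first t : coprime r t ->
    (forall k, k < (omega d).+1 -> ~~ coprime (t + k * r) d) ->
    prime (omega d) /\ omega d %| t.
  move=> copt nct.
  case: (ap_collision prd copt (ltnSn (omega d))) => [k /nct|p [i [j [pd ij pi pij]]]].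
    exact: not_coprime_prime.
  have := dvdn_leq _ pij; have := pdiv_min_primes pd => h1 h2.
  have [ew i0] : p = omega d /\ i = 0 by lia.
  by move: pi; rewrite i0 mul0n addn0 -ew; split=> //; apply: (allP prd).
have [pw ws] : prime (omega d) /\ omega d %| s.
  by apply: dvd_first => // k kw; apply: nc; lia.
have [_] : prime (omega d) /\ omega d %| s + r.
  apply: dvd_first => [|k kw]; first by rewrite /coprime gcdnDr.
  by rewrite -addnA -mulSn; apply: nc.
rewrite dvdn_addr // => wr.
have : omega d %| gcdn r s by rewrite dvdn_gcd wr.
by rewrite (eqP cop) dvdn1 => /eqP w1; move: pw; rewrite w1.
Qed.

(** * Counting the points of a mediant arc *)

(* The vertices x R + y S of a Farey arc around the mediant R + S of two
   fractions with denominators r and s: [T x y] means that x R + y S, whose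
   denominator is x r + y s, is in the arc. *)
Record mediant_arc (d Q r s : nat) (T : rel nat) : Prop := MediantArc {
  arc_r : 0 < r;
  arc_s : 0 < s;
  arc_coprime : coprime r s;
  arc_bound : forall x y, T x y -> [/\ 0 < x, 0 < y & x * r + y * s <= Q];
  arc_bad : forall x y, T x y -> ~~ coprime (x * r + y * s) d;
  arc_primitive : forall x y, T x y -> coprime x y;
  arc_mediant : T 1 1;
  arc_convex : forall x y x' y', T x y -> 0 < x' -> 0 < y' -> coprime x' y' ->
    x' * r + y' * s <= Q ->
    (y' <= x' /\ x' * y <= x * y') \/ (x' <= y' /\ x * y' <= x' * y) -> T x' y'
}.

(** Transfers a bound proved on one side of the mediant to the other side. *)
Lemma mediant_arc_sym d Q r s (T : rel nat) :
  mediant_arc d Q r s T -> mediant_arc d Q s r (fun x y => T y x).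
Proof.
case=> r0 s0 cop bd bad prim med cvx; split=> //.
- by rewrite coprime_sym.
- by move=> x y /bd[]; rewrite addnC.
- by move=> x y /bad; rewrite addnC.
- by move=> x y /prim; rewrite coprime_sym.
move=> x y x' y' t x0 y0 cp; rewrite addnC => le h.
apply: cvx t _ _ _ le _ => //; first by rewrite coprime_sym.
by rewrite ![_ * x']mulnC ![_ * x]mulnC; lia.
Qed.

(** Otherwise the fractions (k+1) R + S with k < w + 2, where w = [omega d], lie between the mediant
    and x R + y S, hence in the arc, and their denominators contradict [ap_coprime_term]. *)
Lemma arc_slope d Q r s (T : rel nat) :
  0 < d -> omega d <= pdiv d -> mediant_arc d Q r s T ->
  forall x y, T x y -> x < (omega d).+2 * y.
Proof.
move=> d0 hd arc x y t; have [x0 y0 le] := arc_bound arc t.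
rewrite ltnNge; apply/negP => xy.
have cop : coprime r (s + r) by rewrite /coprime gcdnDr; exact: arc_coprime arc.
apply: (ap_coprime_term d0 hd cop) => k kw.
have -> : s + r + k * r = k.+1 * r + 1 * s by lia.
apply: (arc_bad arc); apply: (arc_convex arc t) => //; first exact: coprimen1.
  apply: leq_trans le; apply: leq_add; apply: leq_mul => //; nia.
by left; split=> //; rewrite muln1; nia.
Qed.

(* Let k be least with k R + (k+1) S between the mediant and x R + y S. If
   (k + w - 1) (r + s) + s <= Q, where w = omega d, then all the fractions
   j R + (j+1) S with k <= j < k + w are in the arc; their denominators form a
   progression of difference r + s. *)
Lemma arc_thin d Q r s (T : rel nat) :
  0 < d -> omega d <= pdiv d -> mediant_arc d Q r s T ->
  (2 * omega d).-1 * (r + s) <= Q ->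
  forall x y, T x y -> x < y ->
  y = x.+1 /\ x <= (Q - s) %/ (r + s) < x + (omega d).-1.
Proof.
move=> d0 hd arc hQ x y t xy; have [x0 y0 le] := arc_bound arc t.
have r0 := arc_r arc; have s0 := arc_s arc.
set q := r + s in hQ *; have q0 : 0 < q by rewrite addn_gt0 r0.
have badq : ~~ coprime q d.
  by have := arc_bad arc (arc_mediant arc); rewrite !mul1n.
have copq : coprime q s.
  by rewrite coprime_sym /coprime gcdnDr gcdnC; exact: arc_coprime arc.
have w0 : 0 < omega d.
  have [p] := not_coprime_prime d0 badq.
  by rewrite /omega; case: (primes d).
have [n [n0 ey]] : exists n, 0 < n /\ y = x + n by exists (y - x); lia.
(* [k] is the ceiling of x / n, the least index with k / (k + 1) >= x / (x + n). *)
have [k [k0 xk kx]] : exists k, [/\ 0 < k, x <= k * n & (k.-1 * n).+1 <= x].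
  exists (x.-1 %/ n).+1; split=> //=;
    have := divn_eq x.-1 n; have := ltn_pmod x.-1 n0; lia.
have inT j : k <= j -> j * q + s <= Q -> T j j.+1.
  move=> kj jQ; apply: (arc_convex arc t); rewrite ?coprimenS //.
  - by lia.
  - by move: jQ; rewrite /q; nia.
  - by right; split=> //; nia.
have big : Q < (k + (omega d).-1) * q + s.
  rewrite ltnNge; apply/negP => small.
  have cop' : coprime q (s + k * q) by rewrite addnC /coprime gcdnMDl.
  apply: (ap_noncoprime_step d0 hd cop' badq) => j jw.
  have -> : s + k * q + j * q = (k + j) * r + (k + j).+1 * s by rewrite /q; nia.
  apply: (arc_bad arc); apply: inT; first exact: leq_addr.
  by apply: leq_trans small; rewrite leq_add2r leq_mul2r; lia.
have le' : x * q + n * s <= Q by move: le; rewrite ey /q; nia.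
(* If n >= 2, then x >= 2 (k - 1) + 1, and [le'] against [big] forces k < [omega d]; [big] then
   contradicts [hQ]. *)
have n1 : n = 1.
  case: (leqP n 1) => [|n2]; first by lia.
  have : (2 * k.-1).+1 * q + 2 * s <= Q.
    apply: leq_trans le'; apply: leq_add; apply: leq_mul => //; nia.
  by case: k k0 big {xk kx inT} => // k _; case: (omega d) w0 hQ => // w _; nia.
move: le' xk kx; rewrite {}ey {}n1 mul1n => le' xk kx; split; first by rewrite addn1.
have -> : x = k by lia.
have -> : k <= (Q - s) %/ q by rewrite leq_divRL //; nia.
by rewrite ltn_divLR //; nia.
Qed.

Lemma sum_iota_double n : 2 * \sum_(y <- iota 1 n) y = n * n.+1.
Proof.
have -> : \sum_(y <- iota 1 n) y = \sum_(0 <= i < n.+1) i.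
  by rewrite big_ltn // /index_iota subn1.
by elim: n => [|n IH]; rewrite ?big_nat1 // big_nat_recr //= mulnDr IH; lia.
Qed.

Lemma arc_size d Q r s (T : rel nat) (l : seq (nat * nat)) :
  0 < d -> omega d <= pdiv d -> mediant_arc d Q r s T ->
  uniq l -> (forall x y, (x, y) \in l -> T x y) -> size l <= 4 * omega d ^ 3.
Proof.
move=> d0 hd arc ul lT; have arc' := mediant_arc_sym arc.
have r0 := arc_r arc; have s0 := arc_s arc.
have w0 : 0 < omega d.
  have [p] := not_coprime_prime d0 (arc_bad arc (arc_mediant arc)).
  by rewrite /omega; case: (primes d).
set w := omega d in w0 *.
case: (leqP ((2 * w).-1 * (r + s)) Q) => [hQ|hQ].
  (* With M = [(Q - t) %/ (r + s)], [arc_thin] leaves only M - w + 2, ..., M for the smaller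
     coordinate. Truncated subtraction does no harm, as that coordinate is positive. *)
  pose near t := [seq (k, k.+1) | k <- iota ((Q - t) %/ (r + s) - w.-1).+1 w.-1].
  pose box := (1, 1) :: near s ++ [seq (p.2, p.1) | p <- near r].
  have sub : {subset l <= box}.
    move=> [x y] /lT t; rewrite inE mem_cat; have [x0 y0 _] := arc_bound arc t.
    case: (ltngtP x y) => [xy|yx|e].
    - have [ey /andP[h1 h2]] := arc_thin d0 hd arc hQ t xy.
      apply/orP; right; apply/orP; left; apply/mapP; exists x; last by rewrite ey.
      by rewrite mem_iota; rewrite -/w in h2; lia.
    - have hQ' : (2 * w).-1 * (s + r) <= Q by rewrite addnC.
      have [ex /andP[]] := arc_thin d0 hd arc' hQ' t yx.
      rewrite [s + r]addnC -/w => h1 h2.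
      apply/orP; right; apply/orP; right; apply/mapP; exists (y, x) => //.
      by apply/mapP; exists y; last (by rewrite ex); rewrite mem_iota; lia.
    - have := arc_primitive arc t.
      by rewrite e /coprime gcdnn => /eqP ->; rewrite eqxx.
  have /= := uniq_leq_size ul sub.
  rewrite size_cat !size_map !size_iota => /leq_trans; apply.
  by case: (w) w0 => // m _; nia.
(* Here y is the smaller coordinate: if both were at least 2w - 1, the denominator would exceed [Q].
   [arc_slope] leaves for x the (w + 1) y values from y to (w + 2) y - 1. *)
pose cone := [seq (x, y) | y <- iota 1 (2 * w.-1), x <- iota y (w.+1 * y)].
pose box := cone ++ [seq (p.2, p.1) | p <- cone].
have hcone T' r' s' : mediant_arc d Q r' s' T' -> forall x y, T' x y ->
    y <= x -> y <= 2 * w.-1 -> (x, y) \in cone.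
  move=> a x y t yx yw; have [x0 y0 _] := arc_bound a t.
  have := arc_slope d0 hd a t; rewrite -/w => xy.
  by apply/allpairsPdep; exists y, x; rewrite !mem_iota; split=> //; lia.
have sub : {subset l <= box}.
  move=> [x y] /lT t; rewrite mem_cat; have [x0 y0 le] := arc_bound arc t.
  case: (leqP y x) => xy.
    by rewrite (hcone _ _ _ arc _ _ t xy) //; nia.
  apply/orP; right; apply/mapP; exists (y, x) => //.
  apply: (hcone _ _ _ arc' y x t); [exact: ltnW | nia].
have := uniq_leq_size ul sub; rewrite size_cat size_map addnn -mul2n.
have -> : size cone = w.+1 * \sum_(y <- iota 1 (2 * w.-1)) y.
  rewrite size_allpairs_dep sumnE big_map big_distrr /=.
  by apply: eq_bigr => y _; rewrite size_iota.
rewrite mulnCA sum_iota_double => /leq_trans; apply.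
by case: (w) w0 => // m _; nia.
Qed.

(** * From Farey fractions to mediant arcs *)

Lemma ler_nat_frac (a q b t : nat) : 0 < q -> 0 < t ->
  ((a%:R / q%:R <= b%:R / t%:R :> rat)%R = (a * t <= b * q)).
Proof.
move=> q0 t0; rewrite ler_pdivrMr ?ltr0n // mulrAC ler_pdivlMr ?ltr0n //.
by rewrite -!natrM ler_nat.
Qed.

Lemma farey_elt (Q : nat) (v : rat) : v \in farey Q ->
  [/\ (0 < v <= 1)%R, v = (`|numq v|%N%:R / `|denq v|%N%:R)%R,
      0 < `|denq v| <= Q & coprime `|numq v| `|denq v|].
Proof.
case/mem_farey=> a [q [/andP[q0 qQ] cop ev v01]]; split=> //.
- rewrite -[LHS]divq_num_den natr_absz natr_absz !gtr0_norm ?denq_gt0 //.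
  by rewrite numq_gt0; case/andP: v01.
- by rewrite ev denq_frac // q0.
- exact: coprime_num_den.
Qed.

(** [r] is the inverse of [a] modulo [q], and [aR] the quotient in a r = aR q + 1; the other parent
    is the complement. [aR] may be 0. *)
Lemma farey_parents (a q : nat) : 1 < q -> 0 < a <= q -> coprime a q ->
  exists aR r aS s, [/\ 0 < r, 0 < s, r + s = q, aR + aS = a & aS * r = aR * s + 1].
Proof.
move=> q1 /andP[a0 aq] cop.
have [u v e _] := egcdnP q a0.
have q0 : 0 < q by lia.
rewrite (eqP cop) in e.
pose r := u %% q; pose aR := a * r %/ q.
have ear : a * r = aR * q + 1.
  have er : a * r = 1 %[mod q] by rewrite modnMmr mulnC e modnMDl.
  by have := divn_eq (a * r) q; rewrite er modn_small.
have rq : r < q by rewrite ltn_mod.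
have r0 : 0 < r by rewrite lt0n; apply/eqP => rz; move: ear; rewrite rz muln0 addn1.
have aRa : aR <= a by rewrite leqNgt; apply/negP => h; nia.
exists aR, r, (a - aR), (q - r); split; [by []|lia|lia|lia|].
by rewrite mulnBl mulnBr; nia.
Qed.

(** In the coordinates given by the parents R, S of its element of least denominator, [l] becomes a
    [mediant_arc], and [arc_size] applies. *)
Lemma farey_interval_size (d Q : nat) (l : seq rat) :
  0 < d -> omega d <= pdiv d -> uniq l -> {subset l <= farey Q} ->
  (forall lo hi v, lo \in l -> hi \in l -> v \in farey Q ->
     (lo <= v <= hi)%R -> v \in l) ->
  (forall v, v \in l -> ~~ coprime `|denq v| d) -> size l <= 4 * omega d ^ 3.
Proof.
move=> d0 hd ul lF cvx bad.
have [->//|/eqP/eqP] := eqVneq l [::].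
rewrite -size_eq0 -lt0n => l0.
have exq : exists q, q \in [seq `|denq v| | v <- l].
  exists `|denq (nth 0%R l 0)|; apply: map_f; exact: mem_nth.
case: (ex_minnP exq) => q /mapP[e el eq] qmin.
have minq v : v \in l -> q <= `|denq v| by move=> vl; apply/qmin/map_f.
have [e01 ee] := farey_elt (lF _ el).
rewrite -eq in ee *; set a := `|numq e| in ee * => /andP[q0 qQ] cop.
have q1 : 1 < q.
  by case: (ltngtP q 1) q0 => // q1 _; have := bad _ el; rewrite -eq q1 coprime1n.
have a0 : 0 < a <= q.
  move: e01; rewrite {1 2}ee => /andP[h1 h2]; apply/andP; split.
    by move: h1; rewrite pmulr_lgt0 ?invr_gt0 ltr0n.
  by move: h2; rewrite ler_pdivrMr ?ltr0n // mul1r ler_nat.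
have inl b t lo hi : 0 < t <= Q -> coprime b t -> lo \in l -> hi \in l ->
    (lo <= b%:R / t%:R <= hi)%R -> (b%:R / t%:R)%R \in l.
  move=> tQ copt lol hil h; apply: (cvx _ _ _ lol hil _ h); apply/mem_farey.
  exists b, t; split=> //.
  have [/andP[lo0 _] _ _ _] := farey_elt (lF _ lol).
  have [/andP[_ hi1] _ _ _] := farey_elt (lF _ hil).
  case/andP: h => h1 h2.
  by rewrite (lt_le_trans lo0 h1) (le_trans h2 hi1).
have [aR [r [aS [s [r0 s0 ers ea det]]]]] := farey_parents q1 a0 cop.
have cop_of m n m' n' : m * n = m' * n' + 1 -> coprime m m'.
  move=> eqm; rewrite /coprime -dvdn1 -(dvdn_addr 1 (dvdn_mulr n' (dvdn_gcdr m m'))).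
  by rewrite -eqm dvdn_mulr // dvdn_gcdl.
pose phi (p : nat * nat) : rat :=
  ((p.1 * aR + p.2 * aS)%:R / (p.1 * r + p.2 * s)%:R)%R.
pose T x y := [&& 0 < x, 0 < y, coprime x y & phi (x, y) \in l].
(* As the determinant is 1, x and y are integral combinations of the numerator and the denominator,
   so a common divisor of these divides both. *)
have cop_phi x y : coprime x y -> coprime (x * aR + y * aS) (x * r + y * s).
  move=> cxy; rewrite /coprime -dvdn1 -(eqP cxy).
  set g := gcdn _ _.
  have g1 : g %| x * aR + y * aS by apply: dvdn_gcdl.
  have g2 : g %| x * r + y * s by apply: dvdn_gcdr.
  rewrite dvdn_gcd; apply/andP; split.
    rewrite -(dvdn_addl x (dvdn_mulr s g1)).
    suff -> : x + (x * aR + y * aS) * s = (x * r + y * s) * aS by apply: dvdn_mulr.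
    by nia.
  rewrite -(dvdn_addl y (dvdn_mulr aR g2)).
  suff -> : y + (x * r + y * s) * aR = (x * aR + y * aS) * r by apply: dvdn_mulr.
  by nia.
have den_phi x y : 0 < x -> 0 < y -> coprime x y ->
    `|denq (phi (x, y))| = x * r + y * s.
  by move=> x0 y0 cxy; rewrite denq_frac ?cop_phi // addn_gt0 muln_gt0 x0 r0.
have le_phi x y x' y' : 0 < x -> 0 < x' -> 
    (phi (x, y) <= phi (x', y'))%R = (x' * y <= x * y').
  move=> x0 x'0; rewrite ler_nat_frac /= ?addn_gt0 ?muln_gt0 ?x0 ?x'0 ?r0 //.
  have : (x' * aR + y' * aS) * (x * r + y * s) + x' * y =
         (x * aR + y * aS) * (x' * r + y' * s) + x * y' by nia.
  by lia.
have phi1 : phi (1, 1) = e by rewrite /phi /= !mul1n ers ea -ee.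
have arc : mediant_arc d Q r s T.
  split=> //.
  - by apply: (@cop_of r aS s aR); nia.
  - move=> x y /and4P[x0 y0 cxy /lF/farey_elt[_ _ /andP[_]]].
    by rewrite den_phi.
  - by move=> x y /and4P[x0 y0 cxy /bad]; rewrite den_phi.
  - by move=> x y /and4P[].
  - by rewrite /T phi1 el.
  move=> x y x' y' /and4P[x0 y0 cxy tl] x'0 y'0 cxy' le h.
  rewrite /T x'0 y'0 cxy' /=.
  have dQ : 0 < x' * r + y' * s <= Q by rewrite le addn_gt0 muln_gt0 x'0 r0.
  case: h => [[h1 h2]|[h1 h2]].
    apply: (inl _ _ _ _ dQ (cop_phi _ _ cxy') tl el).
    by rewrite -phi1 -/(phi (x', y')) !le_phi //; lia.
  apply: (inl _ _ _ _ dQ (cop_phi _ _ cxy') el tl).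
  by rewrite -phi1 -/(phi (x', y')) !le_phi //; lia.
(* Cramer's rule, inverse to [phi]. The subtractions are truncated, so it must first be shown that v
   lies strictly between R and S. *)
pose vec v := (aS * `|denq v| - `|numq v| * s, `|numq v| * r - aR * `|denq v|).
have vecP v : v \in l -> phi (vec v) = v /\ T (vec v).1 (vec v).2.
  move=> vl; have [_] := farey_elt (lF _ vl).
  rewrite /vec; set b := `|numq v|; set t := `|denq v|.
  move=> ev tQ cbt; have t0 : 0 < t by case/andP: tQ.
  (* If v <= R, then R lies between v and [e], hence in [l], with denominator [r] < [q] against
     minimality; S is treated likewise. *)
  have y0 : aR * t < b * r.
    rewrite ltnNge; apply/negP => h.
    have copR : coprime aR r by rewrite coprime_sym; apply: (@cop_of r aS aR s); nia.
    have rl : (aR%:R / r%:R)%R \in l.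
      apply: (inl _ _ _ _ _ copR vl el); first by lia.
      by rewrite {1}ev ee !ler_nat_frac // h /=; nia.
    by have := minq _ rl; rewrite denq_frac //; lia.
  have x0 : b * s < aS * t.
    rewrite ltnNge; apply/negP => h.
    have copS : coprime aS s by apply: (@cop_of aS r s aR); nia.
    have sl : (aS%:R / s%:R)%R \in l.
      apply: (inl _ _ _ _ _ copS el vl); first by lia.
      by rewrite {1}ev ee !ler_nat_frac // h andbT; nia.
    by have := minq _ sl; rewrite denq_frac //; lia.
  set x := aS * t - b * s; set y := b * r - aR * t.
  have et : x * r + y * s = t by rewrite /x /y; nia.
  have eb : x * aR + y * aS = b by rewrite /x /y; nia.
  have pv : phi (x, y) = v by rewrite /phi /= et eb -ev.
  split=> //; rewrite /T /= pv vl !subn_gt0 x0 y0 andbT /=.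
  rewrite /coprime -dvdn1 -(eqP cbt) dvdn_gcd -[X in _ %| X]eb -[X in _ && (_ %| X)]et.
  by rewrite !dvdn_add // dvdn_mulr ?dvdn_gcdl ?dvdn_gcdr.
rewrite -(size_map vec); apply: (arc_size d0 hd arc).
  rewrite map_inj_in_uniq // => u v ul' vl' euv.
  by rewrite -(vecP u ul').1 euv (vecP v vl').1.
by move=> x y /mapP[v /vecP[_ tv] exy]; move: tv; rewrite -exy.
Qed.

(** * Strings of consecutive fractions and the least length *)

Lemma farey_string_bound (d : nat) :
  0 < d -> omega d <= pdiv d -> coprime_in_strings d (4 * omega d ^ 3).
Proof.
move=> d0 hd Q i Q0; set L := 4 * _ => iL; set F := farey Q in iL *.
case: (boolP (has (fun k => coprime (farey_den Q k) d) (iota i L.+1))).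
  case/hasP=> k; rewrite mem_iota => /andP[ik kL] kc.
  by exists (k - i); [lia | rewrite subnKC].
rewrite -all_predC => /allP nc; exfalso.
pose l := [seq nth 0%R F k | k <- iota i L.+1].
have inF k : k \in iota i L.+1 -> k < size F by rewrite mem_iota; lia.
have uF : uniq F by apply: lt_sorted_uniq; exact: farey_sorted.
have : size l <= L; last by rewrite size_map size_iota ltnn.
apply: (farey_interval_size (Q := Q)) => //.
- rewrite map_inj_in_uniq ?iota_uniq // => j k /inF jF /inF kF /eqP.
  by rewrite nth_uniq // => /eqP.
- by move=> v /mapP[k /inF kF ->]; apply: mem_nth.
- move=> lo hi v /mapP[j jI ->] /mapP[k kI ->] /(nthP 0%R)[m mF <-].
  have jF := inF _ jI; have kF := inF _ kI.
  rewrite !(lt_sorted_leq_nth 0%R (farey_sorted Q)) // => h.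
  by apply: map_f; move: jI kI h; rewrite !mem_iota; lia.
by move=> v /mapP[k /nc kn ->].
Qed.

Theorem lemma2 (d : nat) (hd : 2 <= d) (homega : omega d <= pdiv d) :
  exists L : nat, is_L d L /\ L <= 4 * omega d ^ 3.
Proof.
have := farey_string_bound (ltnW hd) homega.
(* [coprime_in_strings] quantifies over all [Q], so the minimum is reached by descent from the known
   bound, with excluded middle at each stage. *)
elim/ltn_ind: (4 * _) => n IH cn.
case: (classic (exists2 m, m < n & coprime_in_strings d m)) => [[m mn /(IH m mn)]|no].
  by case=> L [isL Lm]; exists L; split=> //; apply: leq_trans Lm (ltnW mn).
exists n; split=> //; split=> // m cm; rewrite leqNgt; apply/negP => mn.
by apply: no; exists m.
Qed.
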